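(* Let $k$, $\ell$, $n$, and $r$ be non-negative integers with $k\neq 0$, and let $\Delta_k=2\sqrt{1+k}$. Then the $k$-Pell number $P_{k,\ell n+r}$ can be represented by the integral $$P_{k,\ell n+r}=\frac{1}{2^{n+1}}\int_{-1}^{1}\left(nP_{k,\ell} Q_{k,r}+P_{k,r} Q_{k,\ell}+(n+1)\Delta_k P_{k,\ell} P_{k,r}\, x\right)\left(Q_{k,\ell}+\Delta_k P_{k,\ell}\, x\right)^{n-1}dx.$$
   Context: For a positive integer $k$, the $k$-Pell numbers $P_{k,n}$ ($n\ge 0$) are defined by $P_{k,0}=0$, $P_{k,1}=1$ and $P_{k,n}=2P_{k,n-1}+kP_{k,n-2}$ for $n\ge 2$. The $k$-Pell-Lucas numbers $Q_{k,n}$ ($n\ge 0$) are defined by $Q_{k,0}=2$, $Q_{k,1}=2$ and $Q_{k,n}=2Q_{k,n-1}+kQ_{k,n-2}$ for $n\ge 2$. *)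

(* Defs.v *)
From Stdlib Require Import Reals.
Open Scope R_scope.

Fixpoint kPell (k n : nat) : nat :=
  match n with
  | O => 0
  | S m => match m with
           | O => 1
           | S p => 2 * kPell k m + k * kPell k p
           end
  end%nat.

Fixpoint kPellLucas (k n : nat) : nat :=
  match n with
  | O => 2
  | S m => match m with
           | O => 2
           | S p => 2 * kPellLucas k m + k * kPellLucas k p
           end
  end%nat.

Definition Delta (k : nat) : R := 2 * sqrt (1 + INR k).

(** The exponent [n - 1] is an integer, so that it is [-1] when [n = 0].  In
    that case, for odd [l], the base [Q_{k,l} + Delta_k P_{k,l} x] has one
    zero in [[-1, 1]]; [powerRZ] is total, and its unspecified value at this
    single point has no effect on the integral. *)
Definition kPell_integrand (k l n r : nat) (x : R) : R :=
  (INR n * INR (kPell k l) * INR (kPellLucas k r)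
   + INR (kPell k r) * INR (kPellLucas k l)
   + (INR n + 1) * Delta k * INR (kPell k l) * INR (kPell k r) * x)
  * powerRZ (INR (kPellLucas k l) + Delta k * INR (kPell k l) * x)
            (Z.of_nat n - 1).

(* Main.v *)
Require Import Defs.
From Stdlib Require Import Reals Lra Lia.
From Coquelicot Require Import Coquelicot.
Open Scope R_scope.

(** Write [s = sqrt (1 + k)], so that [Delta k = 2 s], and let [P], [Q] be
    [P_{k,l}], [Q_{k,l}] and [p], [q] be [P_{k,r}], [Q_{k,r}].  The formula
    holds because the integrand is an exact derivative: with
    [u(x) = Q + Delta P x], the product rule gives
    [d/dx (u^n (q / Delta + p x))
       = (n P q + p Q + (n + 1) Delta P p x) u^(n-1)].
    The endpoints are where Binet's formulas enter: [Q_m + Delta P_m] is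
    [2 (1 + s)^m] and [Q_m - Delta P_m] is [2 (1 - s)^m] ([kPell_conjugates]),
    hence the primitive takes the values
    [2^(n+1) (1 + s)^(l n + r) / Delta] at [1] and
    [2^(n+1) (1 - s)^(l n + r) / Delta] at [-1].  Their difference is
    [2^(n+1) P_{k, l n + r}], by Binet's formula once more.

    This covers [n >= 1], including [l = 0] because the primitive does not
    divide by [P = 0].  For [n = 0] the integrand is [p u / u], which is the constant
    [p] except at a possible zero of [u]; a single point does not
    change the integral ([is_RInt_ext_except_point]). *)

(** The recurrence makes both [Q_n + 2 s P_n] and [Q_n - 2 s P_n] geometric
    sequences, since [1 + s] and [1 - s] are the roots of [t^2 = 2 t + k].
    Both signs are covered by letting [s] be either square root of [1 + k]. *)
Lemma kPell_conjugates (k : nat) (s : R) (hs : s * s = 1 + INR k) (n : nat) :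
  INR (kPellLucas k n) + 2 * s * INR (kPell k n) = 2 * (1 + s) ^ n.
Proof.
enough (H : INR (kPellLucas k n) + 2 * s * INR (kPell k n) = 2 * (1 + s) ^ n
  /\ INR (kPellLucas k (S n)) + 2 * s * INR (kPell k (S n))
     = 2 * (1 + s) ^ S n) by apply H.
induction n as [|n [IH0 IH1]].
- simpl; lra.
- split; [exact IH1|].
  change (kPellLucas k (S (S n)))
    with (2 * kPellLucas k (S n) + k * kPellLucas k n)%nat.
  change (kPell k (S (S n))) with (2 * kPell k (S n) + k * kPell k n)%nat.
  rewrite !plus_INR, !mult_INR.
  change (INR 2) with 2.
  replace (2 * (1 + s) ^ S (S n))
    with (2 * (2 * (1 + s) ^ S n) + INR k * (2 * (1 + s) ^ n)).
  + rewrite <- IH0, <- IH1; ring.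
  + replace (INR k) with (s * s - 1) by lra; simpl; ring.
Qed.

(** Extensionality of the integral only looks at the open interval, so
    cutting at the exceptional point turns it into an endpoint, where the
    values are irrelevant. *)
Lemma is_RInt_ext_except_point (f g : R -> R) (a b x0 v : R) (hab : a <= b)
  (hfg : forall x, x <> x0 -> g x = f x) :
  is_RInt g a b v -> is_RInt f a b v.
Proof.
intros hg.
destruct (Rle_dec a x0) as [h1|h1]; [destruct (Rle_dec x0 b) as [h2|h2]|].
- assert (ha : ex_RInt g a x0).
  { apply (ex_RInt_Chasles_1 g a x0 b); [lra | now exists v]. }
  assert (hb : ex_RInt g x0 b).
  { apply (ex_RInt_Chasles_2 g a x0 b); [lra | now exists v]. }
  destruct ha as [Ia ha], hb as [Ib hb].
  replace v with (plus Ia Ib).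
  + apply (is_RInt_Chasles f a x0 b).
    * apply (is_RInt_ext g); [|exact ha].
      rewrite Rmin_left, Rmax_right by lra.
      intros x hx; apply hfg; lra.
    * apply (is_RInt_ext g); [|exact hb].
      rewrite Rmin_left, Rmax_right by lra.
      intros x hx; apply hfg; lra.
  + rewrite <- (is_RInt_unique g a b v hg).
    symmetry; apply is_RInt_unique; apply (is_RInt_Chasles g a x0 b); assumption.
- apply (is_RInt_ext g); [|exact hg].
  rewrite Rmin_left, Rmax_right by lra.
  intros x hx; apply hfg; lra.
- apply (is_RInt_ext g); [|exact hg].
  rewrite Rmin_left, Rmax_right by lra.
  intros x hx; apply hfg; lra.
Qed.

(** A primitive is [(Q + D P x)^(n+1) (q / D + p x)]: the coefficients of the
    integrand are those that the product rule leaves after taking out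
    [(Q + D P x)^n]. *)
Lemma is_RInt_power_affine (P Q p q D : R) (n : nat) (hD : D <> 0) :
  is_RInt
    (fun x => (INR (S n) * P * q + p * Q + (INR (S n) + 1) * D * P * p * x)
              * (Q + D * P * x) ^ n) (-1) 1
    ((Q + D * P) ^ S n * (q / D + p) - (Q - D * P) ^ S n * (q / D - p)).
Proof.
pose (F := fun x => (Q + D * P * x) ^ S n * (q / D + p * x)).
replace ((Q + D * P) ^ S n * (q / D + p) - (Q - D * P) ^ S n * (q / D - p))
  with (minus (F 1) (F (-1))).
- apply (is_RInt_derive F).
  + intros x _; unfold F; auto_derive; [exact I|].
    change (Init.Nat.pred (S n)) with n.
    change (match n with O => 1 | S _ => INR n + 1 end) with (INR (S n)).
    simpl pow; field; exact hD.
  + intros x _.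
    apply (ex_derive_continuous (V := R_NormedModule)).
    auto_derive; exact I.
- unfold F, minus, plus, opp; simpl.
  replace (Q + D * P * 1) with (Q + D * P) by ring.
  replace (Q + D * P * -1) with (Q - D * P) by ring.
  ring.
Qed.

(** The quotient is the constant [p] wherever the denominator is nonzero, and
    [hPQ] says that the denominator is not identically zero, so it has at
    most one root. *)
Lemma is_RInt_div_affine (P Q p D : R) (hPQ : D * P <> 0 \/ Q <> 0) :
  is_RInt (fun x => (p * Q + D * P * p * x) * / (Q + D * P * x)) (-1) 1
    (2 * p).
Proof.
(* For [D P = 0] there is no root and any exceptional point will do. *)
apply (is_RInt_ext_except_point _ (fun _ => p) (-1) 1 (- Q / (D * P))).
- lra.
- intros x hx.
  assert (hu : Q + D * P * x <> 0).
  { intros hu; destruct (Req_dec (D * P) 0) as [h|h].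
    - rewrite h in hu; destruct hPQ; lra.
    - apply hx; field_simplify_eq; [lra | split; intros E; apply h; rewrite E; ring]. }
  field; exact hu.
- replace (2 * p) with (scal (1 - -1) p) by (unfold scal; simpl; unfold mult; simpl; ring).
  apply (is_RInt_const (V := R_NormedModule)).
Qed.

Lemma is_RInt_kPell_integrand (k l n r : nat) :
  is_RInt (kPell_integrand k l n r) (-1) 1
    (2 ^ (n + 1) * INR (kPell k (l * n + r))).
Proof.
unfold kPell_integrand, Defs.Delta.
set (s := sqrt (1 + INR k)).
pose proof (pos_INR k) as hk0.
assert (hs : s * s = 1 + INR k) by (apply sqrt_sqrt; lra).
assert (hs0 : 0 < s) by (apply sqrt_lt_R0; lra).
assert (hs' : (- s) * (- s) = 1 + INR k) by lra.
pose proof (kPell_conjugates k s hs) as Ha.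
pose proof (kPell_conjugates k (- s) hs') as Hb.
destruct n as [|n].
- replace (l * 0 + r)%nat with r by lia.
  replace (2 ^ (0 + 1) * INR (kPell k r)) with (2 * INR (kPell k r)) by (simpl; ring).
  apply (is_RInt_ext (fun x =>
    (INR (kPell k r) * INR (kPellLucas k l)
     + 2 * s * INR (kPell k l) * INR (kPell k r) * x)
    * / (INR (kPellLucas k l) + 2 * s * INR (kPell k l) * x))).
  + intros x _; change (Z.of_nat 0 - 1)%Z with (-1)%Z.
    change (INR 0) with 0.
    unfold powerRZ; rewrite pow_1; f_equal; ring.
  + apply is_RInt_div_affine.
    (* [Q] and [Delta P] cannot both vanish: their sum is [2 (1 + s)^l > 0]. *)
    pose proof (pow_lt (1 + s) l ltac:(lra)) as h.
    specialize (Ha l).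
    destruct (Req_dec (INR (kPellLucas k l)) 0); [left | right]; lra.
- set (P := INR (kPell k l)); set (Q := INR (kPellLucas k l)).
  set (p := INR (kPell k r)); set (q := INR (kPellLucas k r)).
  replace (Z.of_nat (S n) - 1)%Z with (Z.of_nat n) by lia.
  apply (is_RInt_ext (fun x =>
    (INR (S n) * P * q + p * Q + (INR (S n) + 1) * (2 * s) * P * p * x)
    * (Q + 2 * s * P * x) ^ n)).
  { intros x _; rewrite <- pow_powerRZ; reflexivity. }
  replace (2 ^ (S n + 1) * INR (kPell k (l * S n + r)))
    with ((Q + 2 * s * P) ^ S n * (q / (2 * s) + p)
          - (Q - 2 * s * P) ^ S n * (q / (2 * s) - p));
    [apply is_RInt_power_affine; lra|].
  unfold P, Q, p, q; clear P Q p q.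
  set (m := (l * S n + r)%nat).
  (* Binet's formula, by subtracting the two conjugate identities. *)
  replace (INR (kPell k m)) with (((1 + s) ^ m - (1 + - s) ^ m) / (2 * s)).
  2:{ specialize (Ha m); specialize (Hb m); field_simplify_eq; lra. }
  rewrite Ha.
  replace (INR (kPellLucas k l) - 2 * s * INR (kPell k l))
    with (2 * (1 + - s) ^ l) by (rewrite <- Hb; ring).
  replace (INR (kPellLucas k r) / (2 * s) + INR (kPell k r))
    with (2 * (1 + s) ^ r / (2 * s)) by (rewrite <- Ha; field; lra).
  replace (INR (kPellLucas k r) / (2 * s) - INR (kPell k r))
    with (2 * (1 + - s) ^ r / (2 * s)) by (rewrite <- Hb; field; lra).
  unfold m; rewrite !pow_add, !Rpow_mult_distr, <- !pow_mult.
  rewrite pow_1; field; lra.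
Qed.

Theorem theorem3p8 (k l n r : nat) (hk : k <> 0%nat) :
  ex_RInt (kPell_integrand k l n r) (-1) 1 /\
  INR (kPell k (l * n + r)) =
    1 / 2 ^ (n + 1) * RInt (kPell_integrand k l n r) (-1) 1.
Proof.
pose proof (is_RInt_kPell_integrand k l n r) as H.
split; [eexists; exact H|].
rewrite (is_RInt_unique _ _ _ _ H).
field; apply pow_nonzero; lra.
Qed.
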